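(* Let $1 \le p \le \infty$, and equip $C^1[0,1]$ with the norm $\|\cdot\|_{\sigma,p}$. Let $\Delta \colon S^+_{C^1,p} \to S^+_{C^1,p}$ be a surjective isometry. Then there exists a surjective complex-linear isometry $T \colon C^1[0,1] \to C^1[0,1]$ such that $T|_{S^+_{C^1,p}} = \Delta$. Moreover, $T$ is represented as $$T(f)(t) = f(0) + \int_0^t f'(\tau(x))\,dx \qquad (f \in C^1[0,1],\ t \in [0,1]),$$ where $\tau \colon [0,1] \to [0,1]$ is a homeomorphism.
   Context: $C^1[0,1]$ is the space of all continuously differentiable complex-valued functions on $[0,1]$, with norm $\|f\|_{\sigma,p} = (|f(0)|^p + \|f'\|_\infty^p)^{1/p}$ for $1 \le p < \infty$ and $\|f\|_{\sigma,\infty} = \max\{|f(0)|, \|f'\|_\infty\}$, where $\|\cdot\|_\infty$ is the supremum norm. $C^1_{\mathbb{R}}[0,1]$ is the real subspace of real-valued functions in $C^1[0,1]$, ordered by: $f \le g$ if and only if $f(0) \le g(0)$ and $f' \le g'$ on $[0,1]$. The positive part of the unit sphere is $S^+_{C^1,p} = \{ f \in C^1_{\mathbb{R}}[0,1] : \|f\|_{\sigma,p} = 1,\ f \ge 0\}$, where $f \ge 0$ refers to this order (i.e. $f(0) \ge 0$ and $f' \ge 0$ on $[0,1]$). A map $\Delta$ between subsets of normed spaces is an isometry if $\|\Delta(f) - \Delta(g)\| = \|f-g\|$ for all $f,g$ in its domain (no linearity is assumed). *)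

(* Defs.v *)
From Stdlib Require Import Reals Lra FunctionalExtensionality ProofIrrelevance.
From Coquelicot Require Import Coquelicot.
Open Scope R_scope.

(** * The unit interval, with the metric induced by [R] *)

Definition I01 : Type := {x : R | 0 <= x <= 1}.

Definition I01_val (x : I01) : R := proj1_sig x.
Coercion I01_val : I01 >-> R.

Lemma I01_eq (x y : I01) : (x : R) = y -> x = y.
Proof.
destruct x as [x Hx], y as [y Hy]; simpl; intros ->.
f_equal; apply proof_irrelevance.
Qed.

Definition I01_0 : I01 := exist _ 0 (conj (Rle_refl 0) Rle_0_1).

Definition I01_ball (x : I01) (e : R) (y : I01) : Prop := ball (x : R) e (y : R).

Definition I01_UniformSpace_mixin : UniformSpace.mixin_of I01 :=
  UniformSpace.Mixin I01 I01_0 I01_ball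
    (fun x e => ball_center (x : R) e)
    (fun x y e => ball_sym (x : R) (y : R) e)
    (fun x y z e1 e2 => ball_triangle (x : R) (y : R) (z : R) e1 e2).
Canonical I01_UniformSpace :=
  UniformSpace.Pack I01 I01_UniformSpace_mixin I01.

Definition homeomorphism {U V : UniformSpace} (tau : U -> V) : Prop :=
  exists sigma : V -> U,
    (forall x, sigma (tau x) = x) /\ (forall y, tau (sigma y) = y) /\
    (forall x, continuous tau x) /\ (forall y, continuous sigma y).

Lemma clamp_bounds (x : R) : 0 <= Rmax 0 (Rmin 1 x) <= 1.
Proof.
split; [apply Rmax_l|].
apply Rmax_lub; [lra | apply Rmin_l].
Qed.

(** Retraction of [R] onto the unit interval.  It only serves to feed functions
    defined on [0,1] to [RInt], which expects functions on [R]. *)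
Definition clamp (x : R) : I01 := exist _ (Rmax 0 (Rmin 1 x)) (clamp_bounds x).

Lemma clamp_id (x : I01) : clamp x = x.
Proof.
apply I01_eq; destruct x as [x [H0 H1]]; simpl.
rewrite Rmin_right, Rmax_right; lra.
Qed.

(** * The space C^1[0,1] of complex-valued functions *)

(** Limit of the difference quotient inside [0,1], hence a one-sided derivative
    at the endpoints. *)
Definition is_derive_I01 (f : I01 -> C) (x : I01) (l : C) : Prop :=
  filterlim (fun y : I01 => ((f y - f x) / RtoC (y - x))%C)
    (locally' x) (locally l).

(** The derivative is carried along with the function; as it is unique, an
    element is determined by its values, see [C1_ext]. *)
Record C1_01 : Type := mkC1_01 {
  C1_val :> I01 -> C;
  C1_deriv : I01 -> C;
  C1_derivP : forall x, is_derive_I01 C1_val x (C1_deriv x);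
  C1_contP : forall x, continuous C1_deriv x
}.

Instance I01_locally'_proper (x : I01) : ProperFilter' (locally' x).
Proof.
split.
- intros [e He].
  assert (He0 := cond_pos e).
  destruct x as [x Hx].
  assert (Hd : 0 < Rmin (1/2) (e/2)) by (apply Rmin_pos; lra).
  assert (Hd1 := Rmin_l (1/2) (e/2)); assert (Hd2 := Rmin_r (1/2) (e/2)).
  set (d := Rmin (1/2) (e/2)) in *.
  assert (HE : exists y, (0 <= y <= 1) /\ y <> x /\ Rabs (y - x) < e).
  { destruct (Rle_dec x (1/2)).
    - exists (x + d); split; [lra | split; [lra |]].
      rewrite Rabs_right; lra.
    - exists (x - d); split; [lra | split; [lra |]].
      rewrite Rabs_left; lra. }
  destruct HE as [y [Hy [Hne Hlt]]].
  apply (He (exist _ y Hy)).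
  + exact Hlt.
  + intros E; apply Hne; exact (f_equal I01_val E).
- unfold locally'; apply within_filter, locally_filter.
Qed.

Lemma is_derive_I01_unique (f : I01 -> C) (x : I01) (l1 l2 : C) :
  is_derive_I01 f x l1 -> is_derive_I01 f x l2 -> l1 = l2.
Proof. exact (filterlim_locally_unique (V := C_NormedModule) _ l1 l2). Qed.

Lemma C1_eq (f g : C1_01) :
  (forall x, f x = g x) -> (forall x, C1_deriv f x = C1_deriv g x) -> f = g.
Proof.
destruct f as [f df Hf Cf], g as [g dg Hg Cg]; simpl; intros E1 E2.
apply functional_extensionality in E1, E2; subst g dg.
f_equal; apply proof_irrelevance.
Qed.

Lemma C1_ext (f g : C1_01) : (forall x, f x = g x) -> f = g.
Proof.
intros E; apply C1_eq; [exact E |]; intros x.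
apply (is_derive_I01_unique f x); [apply C1_derivP |].
replace (C1_val f) with (C1_val g); [apply C1_derivP |].
apply functional_extensionality; intros y; symmetry; apply E.
Qed.

(** ** Vector space structure over the complex numbers *)

Lemma is_derive_I01_const (c : C) (x : I01) : is_derive_I01 (fun _ => c) x (RtoC 0).
Proof.
apply filterlim_ext with (fun _ => RtoC 0); [| apply filterlim_const].
intros y; unfold Cdiv; ring.
Qed.

Lemma is_derive_I01_plus (f g : I01 -> C) (x : I01) (l m : C) :
  is_derive_I01 f x l -> is_derive_I01 g x m ->
  is_derive_I01 (fun y => (f y + g y)%C) x (l + m)%C.
Proof.
intros Hf Hg.
apply filterlim_ext with
  (fun y : I01 => plus (((f y - f x) / RtoC (y - x))%C : C_NormedModule)
                       ((g y - g x) / RtoC (y - x))%C).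
- intros y; unfold Cdiv; simpl; unfold plus; simpl; ring.
- exact (filterlim_comp_2 _ _ _ Hf Hg (filterlim_plus (V := C_NormedModule) l m)).
Qed.

Lemma is_derive_I01_scal (c : C) (f : I01 -> C) (x : I01) (l : C) :
  is_derive_I01 f x l -> is_derive_I01 (fun y => (c * f y)%C) x (c * l)%C.
Proof.
intros Hf.
apply filterlim_ext with
  (fun y : I01 => scal c (((f y - f x) / RtoC (y - x))%C : C_NormedModule)).
- intros y; unfold Cdiv, scal; simpl; unfold mult; simpl; ring.
- exact (filterlim_comp _ _ _ _ _ _ _ _ Hf
           (filterlim_scal_r (V := C_NormedModule) c l)).
Qed.

Definition C1_zero : C1_01 :=
  mkC1_01 (fun _ => RtoC 0) (fun _ => RtoC 0)
    (fun x => is_derive_I01_const (RtoC 0) x)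
    (fun x => continuous_const (RtoC 0 : C_UniformSpace) x).

Definition C1_plus (f g : C1_01) : C1_01 :=
  mkC1_01 (fun x => (f x + g x)%C) (fun x => (C1_deriv f x + C1_deriv g x)%C)
    (fun x => is_derive_I01_plus f g x _ _ (C1_derivP f x) (C1_derivP g x))
    (fun x => continuous_plus (V := C_NormedModule) _ _ x
                (C1_contP f x) (C1_contP g x)).

Definition C1_scal (c : C) (f : C1_01) : C1_01 :=
  mkC1_01 (fun x => (c * f x)%C) (fun x => (c * C1_deriv f x)%C)
    (fun x => is_derive_I01_scal c f x _ (C1_derivP f x))
    (fun x => continuous_scal_r (V := C_NormedModule) c _ x (C1_contP f x)).

Definition C1_opp (f : C1_01) : C1_01 := C1_scal (RtoC (-1)) f.

Lemma C1_plus_comm f g : C1_plus f g = C1_plus g f.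
Proof. apply C1_ext; intros x; simpl; ring. Qed.

Lemma C1_plus_assoc f g h :
  C1_plus f (C1_plus g h) = C1_plus (C1_plus f g) h.
Proof. apply C1_ext; intros x; simpl; ring. Qed.

Lemma C1_plus_zero_r f : C1_plus f C1_zero = f.
Proof. apply C1_ext; intros x; simpl; ring. Qed.

Lemma C1_plus_opp_r f : C1_plus f (C1_opp f) = C1_zero.
Proof. apply C1_ext; intros x; simpl; ring. Qed.

Definition C1_AbelianMonoid_mixin :=
  AbelianMonoid.Mixin C1_01 C1_plus C1_zero
    C1_plus_comm C1_plus_assoc C1_plus_zero_r.
Canonical C1_AbelianMonoid := AbelianMonoid.Pack C1_01 C1_AbelianMonoid_mixin C1_01.

Definition C1_AbelianGroup_mixin :=
  AbelianGroup.Mixin C1_AbelianMonoid C1_opp C1_plus_opp_r.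
Canonical C1_AbelianGroup :=
  AbelianGroup.Pack C1_01 (AbelianGroup.Class _ _ C1_AbelianGroup_mixin) C1_01.

Lemma C1_scal_assoc (a b : C) f : C1_scal a (C1_scal b f) = C1_scal (a * b)%C f.
Proof. apply C1_ext; intros x; simpl; ring. Qed.

Lemma C1_scal_one f : C1_scal (RtoC 1) f = f.
Proof. apply C1_ext; intros x; simpl; ring. Qed.

Lemma C1_scal_distr_l (a : C) f g :
  C1_scal a (C1_plus f g) = C1_plus (C1_scal a f) (C1_scal a g).
Proof. apply C1_ext; intros x; simpl; ring. Qed.

Lemma C1_scal_distr_r (a b : C) f :
  C1_scal (a + b)%C f = C1_plus (C1_scal a f) (C1_scal b f).
Proof. apply C1_ext; intros x; simpl; ring. Qed.

Definition C1_ModuleSpace_mixin :=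
  ModuleSpace.Mixin C_Ring C1_AbelianGroup C1_scal
    C1_scal_assoc C1_scal_one C1_scal_distr_l C1_scal_distr_r.
Canonical C1_ModuleSpace :=
  ModuleSpace.Pack C_Ring C1_01 (ModuleSpace.Class C_Ring _ _ C1_ModuleSpace_mixin) C1_01.

(** Coquelicot's [is_linear] also asks for normed modules and boundedness. *)
Definition linear_map {K : Ring} {U V : ModuleSpace K} (T : U -> V) : Prop :=
  (forall f g : U, T (plus f g) = plus (T f) (T g)) /\
  (forall (c : K) (f : U), T (scal c f) = scal c (T f)).

(** * The norms *)

(** The least upper bound is finite for continuous [g]. *)
Definition sup_norm (g : I01 -> C) : R :=
  real (Lub_Rbar (fun r => exists x : I01, r = Cmod (g x))).

(** Power of a nonnegative real with positive exponent; [Rpower] is not usable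
    as such because [Rpower 0 q = 1]. *)
Definition nnpow (x q : R) : R :=
  if Req_EM_T x 0 then 0 else Rpower x q.

(** The value at [m_infty] is irrelevant: only [1 <= p] is used. *)
Definition norm_sigma (p : Rbar) (f : C1_01) : R :=
  match p with
  | Finite q =>
      nnpow (nnpow (Cmod (f I01_0)) q + nnpow (sup_norm (C1_deriv f)) q) (1 / q)
  | p_infty => Rmax (Cmod (f I01_0)) (sup_norm (C1_deriv f))
  | m_infty => 0
  end.

(** * Real-valued functions, order, and the positive part of the unit sphere *)

Definition C1_real (f : C1_01) : Prop := forall x, Im (f x) = 0.

(** Meant for real-valued functions, for which [f'] is real-valued as well. *)
Definition C1_le (f g : C1_01) : Prop :=
  Re (f I01_0) <= Re (g I01_0) /\
  forall x, Re (C1_deriv f x) <= Re (C1_deriv g x).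

Definition pos_sphere (p : Rbar) : Type :=
  {f : C1_01 | C1_real f /\ norm_sigma p f = 1 /\ C1_le zero f}.

Definition pos_sphere_val {p : Rbar} (f : pos_sphere p) : C1_01 := proj1_sig f.
Coercion pos_sphere_val : pos_sphere >-> C1_01.

Definition surjective {A B : Type} (F : A -> B) : Prop :=
  forall b, exists a, F a = b.

(* Main.v *)
Require Import Defs.
From Stdlib Require Import Reals Lra ProofIrrelevance IndefiniteDescription.
From Coquelicot Require Import Coquelicot.

(** A function [f] in the positive part of the sphere is the same thing as the
    pair [(a, u)] with [a = f(0) >= 0] and [u = f' >= 0]; the distance between
    two such functions only involves [|a - b|] and [||u - v||].  The point is
    that [Delta] has the form [(a, u) |-> (a, u o tau)]; the formula for [T]
    then makes sense on the whole space and gives a linear isometry.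

    For finite [p] the diameter of the positive sphere is [2^(1/p)], attained
    exactly between [(1, 0)] and the pairs [(0, u)] with [||u|| = 1].  Hence
    [Delta] fixes [(1, 0)]; the distance to that point determines [a], so
    [Delta] preserves [a] and, as a consequence, the distances [||u - v||]
    ([finite_isometry_parts]).  As [a] is a function of [||u||], [Delta] is now
    a norm-preserving isometry of the functions [0 <= u <= 1] on [0,1].  For
    [p = infinity] the pairs are the functions of norm 1 on the disjoint union
    of a point and [0,1], with the supremum distance.

    Both situations are covered by [isometry_is_composition].  Let
    [Z_x = {h : h(x) = 0}].  If [k(x) = 1] then all members of [Z_x] are at
    distance at least 1 from [k], and for suitable [k] peaking only at [x] the
    set [{h : d(h, k) >= 1}] is exactly [Z_x].  Thus the sets [Z_x] are the
    minimal sets of this form, and [Delta] permutes them, along a bijection of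
    the underlying space.  Moreover [w(x)] is the distance from [w] to [Z_x],
    so that [Delta] is the composition with that bijection.

    For [p = infinity] the image of [(1, 0)] takes only the values 0 and 1, so
    its derivative is constant, which forces the isolated point to be fixed.
    Finally [tau] is the derivative of [Delta W], where [W'(x) = x], hence it is
    continuous, and so is its inverse for the same reason. *)

(** * Calculus on the unit interval *)

(** Real counterpart of [is_derive_I01]. *)
Definition is_derive_real (u : I01 -> R) (x : I01) (l : R) : Prop :=
  filterlim (fun y : I01 => (u y - u x) / (y - x)) (locally' x) (locally l).

Lemma I01_bounds (x : I01) : 0 <= x <= 1.
Proof. exact (proj2_sig x). Qed.

Lemma clamp_val (x : R) : 0 <= x <= 1 -> (clamp x : R) = x.
Proof. intros H; simpl; rewrite Rmin_right, Rmax_right; lra. Qed.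

Lemma clamp_lipschitz (x y : R) : Rabs (clamp y - clamp x) <= Rabs (y - x).
Proof.
  simpl. unfold Rmax, Rmin, Rabs.
  repeat (destruct (Rle_dec _ _)); repeat (destruct (Rcase_abs _)); lra.
Qed.

Lemma continuous_clamp (x : R) : continuous clamp x.
Proof.
  apply filterlim_locally; intros eps.
  exists eps; intros y Hy.
  apply Rle_lt_trans with (2 := Hy).
  apply clamp_lipschitz.
Qed.

Lemma continuous_I01_val (x : I01) : continuous I01_val x.
Proof.
  apply filterlim_locally; intros eps.
  exists eps; intros y Hy; exact Hy.
Qed.

Lemma continuous_Re {U : UniformSpace} (g : U -> C) (x : U) :
  continuous g x -> continuous (fun y => Re (g y)) x.
Proof.
  intros H; apply (continuous_comp g (fun c : C => fst c) x H).
  destruct (g x); apply continuous_fst.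
Qed.

Lemma continuous_Im {U : UniformSpace} (g : U -> C) (x : U) :
  continuous g x -> continuous (fun y => Im (g y)) x.
Proof.
  intros H; apply (continuous_comp g (fun c : C => snd c) x H).
  destruct (g x); apply continuous_snd.
Qed.

Lemma continuous_RtoC {U : UniformSpace} (u : U -> R) (x : U) :
  continuous u x -> continuous (fun y => RtoC (u y)) x.
Proof.
  intros H; apply filterlim_locally; intros eps.
  generalize (proj1 (filterlim_locally _ _) H eps); apply filter_imp.
  intros y Hy; split; [exact Hy | apply ball_center].
Qed.

Lemma continuous_clamp_comp {U : UniformSpace} (g : I01 -> U) :
  (forall x, continuous g x) -> forall x, continuous (fun y => g (clamp y)) x.
Proof.
  intros H x; apply continuous_comp; [apply continuous_clamp | apply H].
Qed.

Lemma I01_sub_neq (x y : I01) : y <> x -> y - x <> 0.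
Proof. intros H E; apply H, I01_eq; lra. Qed.

(** The difference quotient of a complex function splits into the ones of its
    real and imaginary parts, away from the base point. *)
Lemma diff_quotient_parts (a : C) (d : R) :
  d <> 0 -> (a / RtoC d)%C = (Re a / d, Im a / d).
Proof.
  intros H; destruct a as [a b]; unfold Cdiv, Cmult, Cinv; simpl.
  f_equal; field; nra.
Qed.

Lemma is_derive_I01_parts (f : I01 -> C) (x : I01) (l : C) :
  is_derive_I01 f x l <->
  is_derive_real (fun y => Re (f y)) x (Re l) /\
  is_derive_real (fun y => Im (f y)) x (Im l).
Proof.
  assert (HF : Filter (locally' x)) by (unfold locally'; apply within_filter, locally_filter).
  assert (E : forall y : I01, y <> x ->
    ((f y - f x) / RtoC (y - x))%C =
    ((Re (f y) - Re (f x)) / (y - x), (Im (f y) - Im (f x)) / (y - x))).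
  { intros y Hy; rewrite diff_quotient_parts by (now apply I01_sub_neq).
    reflexivity. }
  unfold is_derive_I01, is_derive_real; split.
  - intros H; split; apply filterlim_locally; intros eps;
      generalize (proj1 (filterlim_locally _ _) H eps); unfold locally', within;
      apply filter_imp; intros y Hb Hy; specialize (Hb Hy); rewrite E in Hb by exact Hy;
      apply Hb.
  - intros [H1 H2]; apply filterlim_locally; intros eps.
    generalize (filter_and _ _ (proj1 (filterlim_locally _ _) H1 eps)
                              (proj1 (filterlim_locally _ _) H2 eps)).
    unfold locally', within; apply filter_imp.
    intros y Hb Hy; rewrite E by exact Hy.
    exact (Hb Hy).
Qed.

Lemma is_derive_real_eps (u : I01 -> R) (x : I01) (l : R) :
  is_derive_real u x l <->
  forall eps : posreal, exists d : posreal, forall y : I01,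
    y <> x -> Rabs (y - x) < d -> Rabs ((u y - u x) / (y - x) - l) < eps.
Proof.
  assert (HF : Filter (locally' x)) by (unfold locally'; apply within_filter, locally_filter).
  unfold is_derive_real; rewrite filterlim_locally.
  split; intros H eps; destruct (H eps) as [d Hd]; exists d.
  - intros y Hy Hdy; exact (Hd y Hdy Hy).
  - intros y Hdy Hy; exact (Hd y Hy Hdy).
Qed.

(** Inside the interval the one-sided notion of derivative is the usual one. *)
Lemma is_derive_real_interior (u : I01 -> R) (x : R) (l : R) :
  0 < x < 1 -> is_derive_real u (clamp x) l ->
  is_derive (fun y => u (clamp y)) x l.
Proof.
  intros Hx H; apply is_derive_Reals; intros eps Heps.
  destruct (proj1 (is_derive_real_eps _ _ _) H (mkposreal eps Heps)) as [d Hd].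
  assert (Hm : 0 < Rmin d (Rmin x (1 - x))).
  { repeat apply Rmin_pos; try lra; apply cond_pos. }
  exists (mkposreal _ Hm); intros h Hh0 Hh; simpl in Hh.
  assert (H1 := Rmin_l d (Rmin x (1 - x))).
  assert (H2 := Rmin_r d (Rmin x (1 - x))).
  assert (H3 := Rmin_l x (1 - x)); assert (H4 := Rmin_r x (1 - x)).
  assert (Hh' := Rabs_def2 _ _ Hh).
  assert (E1 : (clamp (x + h) : R) = x + h) by (apply clamp_val; lra).
  assert (E2 : (clamp x : R) = x) by (apply clamp_val; lra).
  specialize (Hd (clamp (x + h))).
  rewrite E1, E2 in Hd; simpl in Hd.
  replace (x + h - x) with h in Hd by ring.
  apply Hd; [| lra].
  intros E; apply (f_equal I01_val) in E.
  change (I01_val (clamp (x + h))) with (clamp (x + h) : R) in E; lra.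
Qed.

Lemma is_derive_real_of_derive (F : R -> R) (x : I01) (l : R) :
  is_derive F (x : R) l -> is_derive_real (fun y : I01 => F y) x l.
Proof.
  intros H; apply is_derive_real_eps; intros eps.
  apply is_derive_Reals in H.
  destruct (H eps (cond_pos eps)) as [d Hd]; exists d; intros y Hy Hyx.
  specialize (Hd (y - x) (I01_sub_neq _ _ Hy) Hyx).
  now replace (x + (y - x)) with (y : R) in Hd by ring.
Qed.

Lemma is_derive_real_continuous (u : I01 -> R) (x : I01) (l : R) :
  is_derive_real u x l -> continuous u x.
Proof.
  intros H; apply filterlim_locally; intros eps.
  destruct (proj1 (is_derive_real_eps _ _ _) H (mkposreal 1 Rlt_0_1)) as [d Hd].
  set (K := Rabs l + 1).
  assert (HK : 0 < K) by (unfold K; pose proof (Rabs_pos l); lra).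
  assert (Hm : 0 < Rmin d (eps / K)).
  { apply Rmin_pos; [apply cond_pos | apply Rdiv_lt_0_compat; [apply cond_pos | exact HK]]. }
  exists (mkposreal _ Hm).
  cut (forall y : I01, Rabs (y - x) < Rmin d (eps / K) -> Rabs (u y - u x) < eps);
    [intros Hc; exact Hc |].
  intros y Hy.
  assert (H1 := Rmin_l d (eps / K)); assert (H2 := Rmin_r d (eps / K)).
  destruct (Req_dec (y - x) 0) as [E | N].
  - replace y with x by (apply I01_eq; lra).
    unfold Rminus; rewrite Rplus_opp_r, Rabs_R0; apply cond_pos.
  - assert (Hne : y <> x) by (intros ->; apply N; ring).
    assert (Hq := Hd y Hne ltac:(lra)); simpl in Hq.
    set (r := (u y - u x) / (y - x)) in *.
    replace (u y - u x) with (r * (y - x)) by (unfold r; field; exact N).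
    rewrite Rabs_mult.
    assert (Hr : Rabs r < K).
    { pose proof (Rabs_triang (r - l) l) as Ht.
      replace (r - l + l) with r in Ht by ring; unfold K; lra. }
    assert (0 < Rabs (y - x)) by (now apply Rabs_pos_lt).
    apply Rlt_le_trans with (K * Rabs (y - x)).
    + apply Rmult_lt_compat_r; assumption.
    + apply Rle_trans with (K * (eps / K)).
      * apply Rmult_le_compat_l; lra.
      * right; field; lra.
Qed.

Lemma is_derive_RInt_clamp (u : I01 -> R) :
  (forall x, continuous u x) ->
  forall x, is_derive (fun t => RInt (fun y => u (clamp y)) 0 t) x (u (clamp x)).
Proof.
  intros Hu x.
  apply (is_derive_RInt (fun y => u (clamp y)) _ 0 x).
  - apply filter_forall; intros b.
    apply (RInt_correct (fun y => u (clamp y))), ex_RInt_continuous.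
    intros z _; apply continuous_clamp_comp, Hu.
  - apply continuous_clamp_comp, Hu.
Qed.

(** Fundamental theorem of calculus on the closed unit interval. *)
Lemma real_ftc (u du : I01 -> R) :
  (forall x, is_derive_real u x (du x)) -> (forall x, continuous du x) ->
  forall t : I01, u t = u I01_0 + RInt (fun y => du (clamp y)) 0 t.
Proof.
  intros Hu Hdu t.
  set (J := fun t => RInt (fun y => du (clamp y)) 0 t).
  assert (HJ : forall x, is_derive J x (du (clamp x)))
    by (apply is_derive_RInt_clamp; exact Hdu).
  assert (Ht := I01_bounds t).
  destruct (MVT_gen (fun x => u (clamp x) - J x) 0 t (fun _ => 0)) as [c [_ Hc]].
  - rewrite Rmin_left, Rmax_right by lra; intros x Hx.
    replace 0 with (du (clamp x) - du (clamp x)) by ring.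
    apply (is_derive_minus (V := R_NormedModule)); [| apply HJ].
    apply is_derive_real_interior; [lra | apply Hu].
  - intros x _; apply continuity_pt_filterlim.
    apply (continuous_minus (V := R_NormedModule) (fun x => u (clamp x)) J).
    + apply (continuous_clamp_comp u); intros y; eapply is_derive_real_continuous, Hu.
    + assert (HJx : ex_derive J x) by (exists (du (clamp x)); apply HJ).
      exact (ex_derive_continuous J x HJx).
  - replace (clamp t) with t in Hc by (symmetry; apply clamp_id).
    replace (clamp 0) with I01_0 in Hc by (symmetry; apply (clamp_id I01_0)).
    replace (J 0) with 0 in Hc by (symmetry; apply (RInt_point (V := R_CompleteNormedModule))).
    fold (J t); lra.
Qed.

Lemma C1_deriv_Re (f : C1_01) (x : I01) :
  is_derive_real (fun y => Re (f y)) x (Re (C1_deriv f x)).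
Proof. apply is_derive_I01_parts, C1_derivP. Qed.

Lemma C1_deriv_Im (f : C1_01) (x : I01) :
  is_derive_real (fun y => Im (f y)) x (Im (C1_deriv f x)).
Proof. apply is_derive_I01_parts, C1_derivP. Qed.

Lemma C1_Re_ftc (f : C1_01) (t : I01) :
  Re (f t) = Re (f I01_0) + RInt (fun y => Re (C1_deriv f (clamp y))) 0 t.
Proof.
  apply (real_ftc (fun y => Re (f y)) (fun y => Re (C1_deriv f y))).
  - apply C1_deriv_Re.
  - intros x; apply continuous_Re, C1_contP.
Qed.

Lemma C1_Im_ftc (f : C1_01) (t : I01) :
  Im (f t) = Im (f I01_0) + RInt (fun y => Im (C1_deriv f (clamp y))) 0 t.
Proof.
  apply (real_ftc (fun y => Im (f y)) (fun y => Im (C1_deriv f y))).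
  - apply C1_deriv_Im.
  - intros x; apply continuous_Im, C1_contP.
Qed.

(** Evaluation at [0] together with the derivative is injective on C^1[0,1]. *)
Lemma C1_determined (f g : C1_01) :
  f I01_0 = g I01_0 -> (forall x, C1_deriv f x = C1_deriv g x) -> f = g.
Proof.
  intros H0 H; apply C1_ext; intros t.
  apply injective_projections.
  - change (Re (f t) = Re (g t)); rewrite (C1_Re_ftc f t), (C1_Re_ftc g t), H0; f_equal.
    apply RInt_ext; intros x _; now rewrite H.
  - change (Im (f t) = Im (g t)); rewrite (C1_Im_ftc f t), (C1_Im_ftc g t), H0; f_equal.
    apply RInt_ext; intros x _; now rewrite H.
Qed.

Lemma C1_real_deriv (f : C1_01) (x : I01) : C1_real f -> Im (C1_deriv f x) = 0.
Proof.
  intros H.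
  assert (HP : ProperFilter' (locally' x)) by apply I01_locally'_proper.
  apply (filterlim_locally_unique (V := R_NormedModule) _ _ _ (C1_deriv_Im f x)).
  apply filterlim_ext with (fun _ => 0); [| apply filterlim_const].
  intros y; rewrite !H; unfold Rdiv; ring.
Qed.

Lemma C1_real_of_deriv (f : C1_01) :
  Im (f I01_0) = 0 -> (forall x, Im (C1_deriv f x) = 0) -> C1_real f.
Proof.
  intros H0 H t; rewrite C1_Im_ftc, H0.
  rewrite (RInt_ext _ (fun _ => 0)) by (intros x _; apply H).
  rewrite RInt_const; unfold scal; simpl; unfold mult; simpl; ring.
Qed.

(** The primitive [c + int_0^t g] of a continuous complex function. *)
Definition primitive (c : C) (g : I01 -> C) (t : I01) : C :=
  (c + RInt (V := C_R_CompleteNormedModule) (fun x : R => g (clamp x)) 0 t)%C.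

Lemma primitive_parts (c : C) (g : I01 -> C) (t : I01) :
  (forall x, continuous g x) ->
  primitive c g t =
    (Re c + RInt (fun x => Re (g (clamp x))) 0 t,
     Im c + RInt (fun x => Im (g (clamp x))) 0 t).
Proof.
  intros Hg; unfold primitive.
  rewrite (is_RInt_unique (V := C_R_CompleteNormedModule) _ 0 t
            (RInt (fun x => Re (g (clamp x))) 0 t,
             RInt (fun x => Im (g (clamp x))) 0 t)); [reflexivity |].
  apply (is_RInt_fct_extend_pair (U := R_NormedModule) (V := R_NormedModule)).
  - apply (RInt_correct (fun x => Re (g (clamp x)))), ex_RInt_continuous.
    intros z _; apply (continuous_clamp_comp (fun y => Re (g y))).
    intros x; apply continuous_Re, Hg.
  - apply (RInt_correct (fun x => Im (g (clamp x)))), ex_RInt_continuous.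
    intros z _; apply (continuous_clamp_comp (fun y => Im (g y))).
    intros x; apply continuous_Im, Hg.
Qed.

Lemma primitive_derive (c : C) (g : I01 -> C) :
  (forall x, continuous g x) ->
  forall x, is_derive_I01 (primitive c g) x (g x).
Proof.
  intros Hg x.
  assert (aux : forall (r : R) (u : I01 -> R), (forall x, continuous u x) ->
    is_derive_real (fun t : I01 => r + RInt (fun y => u (clamp y)) 0 t) x (u x)).
  { intros r u Hu.
    apply (is_derive_real_of_derive (fun t => r + RInt (fun y => u (clamp y)) 0 t)).
    rewrite <- (clamp_id x) at 2; rewrite <- (Rplus_0_l (u (clamp x))).
    apply (is_derive_plus (V := R_NormedModule)).
    - apply is_derive_Reals, derivable_pt_lim_const.
    - apply is_derive_RInt_clamp, Hu. }
  apply is_derive_I01_parts; split.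
  - apply filterlim_ext with (2 := aux (Re c) (fun y => Re (g y))
      (fun z => continuous_Re _ _ (Hg z))).
    intros y; rewrite !primitive_parts by exact Hg; reflexivity.
  - apply filterlim_ext with (2 := aux (Im c) (fun y => Im (g y))
      (fun z => continuous_Im _ _ (Hg z))).
    intros y; rewrite !primitive_parts by exact Hg; reflexivity.
Qed.

(** The primitive of [g] with value [c] at 0, as an element of C^1[0,1]. *)
Definition C1_primitive (c : C) (g : I01 -> C) (Hg : forall x, continuous g x) : C1_01 :=
  mkC1_01 (primitive c g) g (primitive_derive c g Hg) Hg.

Lemma C1_primitive_0 c g Hg : C1_primitive c g Hg I01_0 = c.
Proof.
  simpl; unfold primitive; simpl.
  rewrite (RInt_point (V := C_R_CompleteNormedModule)).
  apply injective_projections; simpl; apply Rplus_0_r.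
Qed.

(** * The norms *)

Lemma sup_norm_spec (g : I01 -> C) :
  (forall x, continuous g x) ->
  (exists x, Cmod (g x) = sup_norm g) /\ forall x, Cmod (g x) <= sup_norm g.
Proof.
  intros Hg.
  destruct (continuity_ab_maj (fun x => Cmod (g (clamp x))) 0 1 Rle_0_1) as [M [HM _]].
  { intros c _; apply continuity_pt_filterlim.
    apply (continuous_comp (fun x => g (clamp x)) (norm (V := C_NormedModule))).
    - apply continuous_clamp_comp, Hg.
    - apply (filterlim_norm (V := C_NormedModule)). }
  assert (HM' : forall x : I01, Cmod (g x) <= Cmod (g (clamp M))).
  { intros x; rewrite <- (clamp_id x) at 1; apply HM, I01_bounds. }
  assert (E : sup_norm g = Cmod (g (clamp M))).
  { unfold sup_norm.
    rewrite (is_lub_Rbar_unique _ (Finite (Cmod (g (clamp M))))); [reflexivity |].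
    split.
    - intros r [x ->]; apply HM'.
    - intros b Hb; apply Hb; now exists (clamp M). }
  rewrite E; split; [now exists (clamp M) | exact HM'].
Qed.

Lemma sup_norm_eq (g : I01 -> C) (m : R) :
  (exists x, Cmod (g x) = m) -> (forall x, Cmod (g x) <= m) -> sup_norm g = m.
Proof.
  intros [z Hz] Hm; unfold sup_norm.
  rewrite (is_lub_Rbar_unique _ (Finite m)); [reflexivity |]; split.
  - intros r [x ->]; apply Hm.
  - intros b Hb; apply Hb; now exists z.
Qed.

Lemma sup_norm_pos (g : I01 -> C) : (forall x, continuous g x) -> 0 <= sup_norm g.
Proof.
  intros Hg; destruct (sup_norm_spec g Hg) as [[x <-] _]; apply Cmod_ge_0.
Qed.

Lemma nnpow_0 q : nnpow 0 q = 0.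
Proof. unfold nnpow; destruct (Req_EM_T 0 0); lra. Qed.

Lemma nnpow_nz x q : x <> 0 -> nnpow x q = Rpower x q.
Proof. intros H; unfold nnpow; destruct (Req_EM_T x 0); [contradiction | reflexivity]. Qed.

Lemma nnpow_1 q : nnpow 1 q = 1.
Proof. rewrite nnpow_nz by lra; unfold Rpower; rewrite ln_1, Rmult_0_r; apply exp_0. Qed.

Lemma nnpow_pos x q : 0 < x -> 0 < nnpow x q.
Proof. intros H; rewrite nnpow_nz by lra; apply exp_pos. Qed.

Lemma nnpow_lt x y q : 0 < q -> 0 <= x < y -> nnpow x q < nnpow y q.
Proof.
  intros Hq [[Hx | <-] Hy].
  - rewrite !nnpow_nz by lra; apply Rlt_Rpower_l; lra.
  - rewrite nnpow_0; apply nnpow_pos; lra.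
Qed.

Lemma nnpow_le x y q : 0 < q -> 0 <= x <= y -> nnpow x q <= nnpow y q.
Proof.
  intros Hq [Hx [Hy | ->]]; [left; apply nnpow_lt; lra | lra].
Qed.

Lemma nnpow_ge_0 x q : 0 < q -> 0 <= x -> 0 <= nnpow x q.
Proof. intros Hq Hx; rewrite <- (nnpow_0 q); apply nnpow_le; lra. Qed.

Lemma nnpow_inj x y q : 0 < q -> 0 <= x -> 0 <= y -> nnpow x q = nnpow y q -> x = y.
Proof.
  intros Hq Hx Hy E; destruct (Rtotal_order x y) as [H | [H | H]].
  - pose proof (nnpow_lt x y q Hq (conj Hx H)); lra.
  - exact H.
  - pose proof (nnpow_lt y x q Hq (conj Hy H)); lra.
Qed.

Lemma nnpow_nnpow x a b : a * b = 1 -> 0 <= x -> nnpow (nnpow x a) b = x.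
Proof.
  intros Hab [Hx | <-]; [| now rewrite !nnpow_0].
  pose proof (nnpow_pos x a Hx).
  rewrite (nnpow_nz (nnpow x a)), nnpow_nz by lra.
  rewrite Rpower_mult, Hab; now apply Rpower_1.
Qed.

(** * Isometries of families of functions *)

(** A family [X] of nonnegative functions on [L], with a distance [d] that
    dominates every evaluation.  The sets [zeros x] of the members vanishing at
    [x] are separated from each other, they are exactly the minimal sets of the
    form [{h : 1 <= d h k}] with [k] in the class [peak] of functions attaining
    the value 1, and the value of [w] at [x] is the distance from [w] to
    [zeros x]. *)
Record evaluation_family {X L : Type} (ev : X -> L -> R) (d : X -> X -> R)
    (peak : X -> Prop) : Prop := {
  ev_ge0 : forall w x, 0 <= ev w x;
  ev_dist : forall v w x, Rabs (ev v x - ev w x) <= d v w;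
  ev_separates : forall x y, (forall h, ev h x = 0 -> ev h y = 0) -> x = y;
  peak_value : forall k, peak k -> exists x, ev k x = 1;
  peak_at : forall x, exists k, peak k /\ forall h, 1 <= d h k -> ev h x = 0;
  ev_nearest : forall w x, exists h, ev h x = 0 /\ d w h <= ev w x
}.

(** If [Phi k] takes the value 1 at [y], where [k] is the peak function at [x],
    then the preimage of [zeros y] is contained in [zeros x].  The same argument
    for the inverse yields some [zeros z] inside that preimage, and separation
    of points gives [z = x]. *)
Lemma zeros_transport {X L : Type} (ev : X -> L -> R) d peak
    (E : evaluation_family ev d peak) (Phi Psi : X -> X) :
  (forall f, Psi (Phi f) = f) -> (forall f, Phi (Psi f) = f) ->
  (forall f g, d (Phi f) (Phi g) = d f g) ->
  (forall f, peak f -> peak (Phi f)) -> (forall f, peak f -> peak (Psi f)) ->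
  forall x, exists y, forall h, ev h x = 0 <-> ev (Phi h) y = 0.
Proof.
  intros HPsi HPhi Hd Hp Hp' x.
  assert (Hd' : forall f g, d (Psi f) (Psi g) = d f g)
    by (intros f g; rewrite <- Hd, !HPhi; reflexivity).
  assert (far : forall h k z, ev k z = 1 -> ev h z = 0 -> 1 <= d h k).
  { intros h k z Hk Hh; apply Rle_trans with (2 := ev_dist _ _ _ E h k z).
    rewrite Hk, Hh, Rabs_left; lra. }
  destruct (peak_at _ _ _ E x) as [k [Hk Hkx]].
  destruct (peak_value _ _ _ E _ (Hp k Hk)) as [y Hy].
  destruct (peak_at _ _ _ E y) as [l [Hl Hly]].
  destruct (peak_value _ _ _ E _ (Hp' l Hl)) as [z Hz].
  assert (A : forall h, ev (Phi h) y = 0 -> ev h x = 0).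
  { intros h Hh; apply Hkx; rewrite <- Hd; exact (far _ _ _ Hy Hh). }
  assert (B : forall h, ev h z = 0 -> ev (Phi h) y = 0).
  { intros h Hh; apply Hly; rewrite <- Hd', HPsi; exact (far _ _ _ Hz Hh). }
  assert (z = x) as <- by (apply (ev_separates _ _ _ E); auto).
  exists y; split; auto.
Qed.

Lemma isometry_is_composition {X L : Type} (ev : X -> L -> R) d peak
    (E : evaluation_family ev d peak) (Phi Psi : X -> X) :
  (forall f, Psi (Phi f) = f) -> (forall f, Phi (Psi f) = f) ->
  (forall f g, d (Phi f) (Phi g) = d f g) ->
  (forall f, peak f -> peak (Phi f)) -> (forall f, peak f -> peak (Psi f)) ->
  exists sigma tau : L -> L,
    (forall x, tau (sigma x) = x) /\ (forall y, sigma (tau y) = y) /\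
    forall w y, ev (Phi w) y = ev w (tau y).
Proof.
  intros HPsi HPhi Hd Hp Hp'.
  assert (Hd' : forall f g, d (Psi f) (Psi g) = d f g)
    by (intros f g; rewrite <- Hd, !HPhi; reflexivity).
  destruct (functional_choice _ (zeros_transport ev d peak E Phi Psi HPsi HPhi Hd Hp Hp'))
    as [sigma Hsigma].
  destruct (functional_choice _ (zeros_transport ev d peak E Psi Phi HPhi HPsi Hd' Hp' Hp))
    as [tau Htau].
  assert (Hts : forall x, tau (sigma x) = x).
  { intros x; symmetry; apply (ev_separates _ _ _ E); intros h Hh.
    apply Hsigma, Htau in Hh; now rewrite HPsi in Hh. }
  assert (Hst : forall y, sigma (tau y) = y).
  { intros y; symmetry; apply (ev_separates _ _ _ E); intros h Hh.
    apply Htau, Hsigma in Hh; now rewrite HPhi in Hh. }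
  exists sigma, tau; split; [exact Hts | split; [exact Hst |]].
  assert (le : forall w h x, ev h x = 0 -> ev w x <= d w h).
  { intros w h x Hh; apply Rle_trans with (2 := ev_dist _ _ _ E w h x).
    rewrite Hh, Rminus_0_r; apply Rle_abs. }
  intros w y; apply Rle_antisym.
  - destruct (ev_nearest _ _ _ E w (tau y)) as [h [Hh Hwh]].
    apply Hsigma in Hh; rewrite Hst in Hh.
    apply Rle_trans with (2 := Hwh); rewrite <- Hd; exact (le _ _ _ Hh).
  - destruct (ev_nearest _ _ _ E (Phi w) y) as [h [Hh Hwh]].
    apply Htau in Hh.
    apply Rle_trans with (2 := Hwh); rewrite <- Hd', HPsi; exact (le _ _ _ Hh).
Qed.

(** * The positive part of the unit sphere *)

(** Value at 0 of an element of the positive sphere; it is a real number. *)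
Definition init {p} (f : pos_sphere p) : R := Re (f I01_0).

(** Derivative of an element of the positive sphere, a nonnegative real function. *)
Definition slope {p} (f : pos_sphere p) (x : I01) : R := Re (C1_deriv f x).

(** Supremum distance of the derivatives. *)
Definition slope_dist {p} (f g : pos_sphere p) : R :=
  sup_norm (C1_deriv (minus (f : C1_01) (g : C1_01))).

Lemma sphere_init_eq {p} (f : pos_sphere p) : (f : C1_01) I01_0 = RtoC (init f).
Proof.
  destruct f as [f [Hr [Hn Hp]]]; unfold init; simpl.
  apply injective_projections; [reflexivity | exact (Hr I01_0)].
Qed.

Lemma sphere_slope_eq {p} (f : pos_sphere p) x : C1_deriv f x = RtoC (slope f x).
Proof.
  destruct f as [f [Hr [Hn Hp]]]; unfold slope; simpl.
  apply injective_projections; [reflexivity | exact (C1_real_deriv f x Hr)].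
Qed.

Lemma init_ge0 {p} (f : pos_sphere p) : 0 <= init f.
Proof. destruct f as [f [Hr [Hn [H0 Hd]]]]; exact H0. Qed.

Lemma slope_ge0 {p} (f : pos_sphere p) x : 0 <= slope f x.
Proof. destruct f as [f [Hr [Hn [H0 Hd]]]]; exact (Hd x). Qed.

Lemma slope_continuous {p} (f : pos_sphere p) x : continuous (slope f) x.
Proof. apply continuous_Re, C1_contP. Qed.

Lemma Cmod_init {p} (f : pos_sphere p) : Cmod ((f : C1_01) I01_0) = init f.
Proof. rewrite sphere_init_eq, Cmod_R; apply Rabs_pos_eq, init_ge0. Qed.

Lemma Cmod_slope {p} (f : pos_sphere p) x : Cmod (C1_deriv f x) = slope f x.
Proof. rewrite sphere_slope_eq, Cmod_R; apply Rabs_pos_eq, slope_ge0. Qed.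

Lemma Cmod_init_minus {p} (f g : pos_sphere p) :
  Cmod ((minus (f : C1_01) (g : C1_01) : C1_01) I01_0) = Rabs (init f - init g).
Proof.
  rewrite <- Cmod_R; f_equal.
  change ((f : C1_01) I01_0 + RtoC (-1) * (g : C1_01) I01_0 = RtoC (init f - init g))%C.
  rewrite !sphere_init_eq, <- RtoC_mult, <- RtoC_plus; f_equal; ring.
Qed.

Lemma Cmod_slope_minus {p} (f g : pos_sphere p) x :
  Cmod (C1_deriv (minus (f : C1_01) (g : C1_01)) x) = Rabs (slope f x - slope g x).
Proof.
  rewrite <- Cmod_R; f_equal.
  change (C1_deriv f x + RtoC (-1) * C1_deriv g x = RtoC (slope f x - slope g x))%C.
  rewrite !sphere_slope_eq, <- RtoC_mult, <- RtoC_plus; f_equal; ring.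
Qed.

Lemma slope_dist_ub {p} (f g : pos_sphere p) x :
  Rabs (slope f x - slope g x) <= slope_dist f g.
Proof. rewrite <- Cmod_slope_minus; apply sup_norm_spec, C1_contP. Qed.

Lemma slope_dist_attained {p} (f g : pos_sphere p) :
  exists x, Rabs (slope f x - slope g x) = slope_dist f g.
Proof.
  destruct (sup_norm_spec _ (C1_contP (minus (f : C1_01) (g : C1_01)))) as [[x Hx] _].
  exists x; rewrite <- Cmod_slope_minus; exact Hx.
Qed.

Lemma slope_dist_ge0 {p} (f g : pos_sphere p) : 0 <= slope_dist f g.
Proof. apply sup_norm_pos, C1_contP. Qed.

Lemma slope_dist_refl {p} (f : pos_sphere p) : slope_dist f f = 0.
Proof.
  destruct (slope_dist_attained f f) as [x <-].
  unfold Rminus; rewrite Rplus_opp_r; apply Rabs_R0.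
Qed.

Lemma slope_dist_0 {p} (f g : pos_sphere p) x : slope_dist f g = 0 -> slope f x = slope g x.
Proof.
  intros H; pose proof (slope_dist_ub f g x) as Hx; rewrite H in Hx.
  unfold Rabs in Hx; destruct (Rcase_abs _); lra.
Qed.

Lemma slope_sup {p} (f : pos_sphere p) :
  (exists x, slope f x = sup_norm (C1_deriv f)) /\
  forall x, slope f x <= sup_norm (C1_deriv f).
Proof.
  destruct (sup_norm_spec _ (C1_contP f)) as [[x Hx] H]; split.
  - exists x; now rewrite <- Cmod_slope.
  - intros y; rewrite <- Cmod_slope; apply H.
Qed.

Lemma sphere_ext {p} (f g : pos_sphere p) :
  init f = init g -> (forall x, slope f x = slope g x) -> f = g.
Proof.
  intros H0 H.
  assert (E : (f : C1_01) = (g : C1_01)).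
  { apply C1_determined.
    - now rewrite !sphere_init_eq, H0.
    - intros x; now rewrite !sphere_slope_eq, H. }
  destruct f as [f Hf], g as [g Hg]; simpl in E; subst g.
  f_equal; apply proof_irrelevance.
Qed.

(** Existence of an element of the positive sphere with given value at 0 and
    given derivative, provided that these data have norm 1. *)
Lemma sphere_make (p : Rbar) (a : R) (u : I01 -> R) :
  (forall x, continuous u x) -> 0 <= a -> (forall x, 0 <= u x) ->
  (forall F : C1_01, Cmod (F I01_0) = a -> (forall x, Cmod (C1_deriv F x) = u x) ->
     norm_sigma p F = 1) ->
  exists f : pos_sphere p, init f = a /\ forall x, slope f x = u x.
Proof.
  intros Hu Ha Hu0 HN.
  pose (F := C1_primitive (RtoC a) (fun x => RtoC (u x)) (fun x => continuous_RtoC u x (Hu x))).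
  assert (E0 : F I01_0 = RtoC a) by apply C1_primitive_0.
  assert (HF : C1_real F /\ norm_sigma p F = 1 /\ C1_le zero F).
  { split; [| split; [| split]].
    - apply C1_real_of_deriv; [now rewrite E0 | reflexivity].
    - apply HN; [rewrite E0 | intros x; simpl]; rewrite Cmod_R; apply Rabs_pos_eq; auto.
    - rewrite E0; exact Ha.
    - exact Hu0. }
  exists (exist _ F HF); split; [| reflexivity].
  unfold init; change (Re (F I01_0) = a); now rewrite E0.
Qed.

Lemma continuous_dominated {U : UniformSpace} (K : R) (u v : U -> R) (x : U) :
  (forall y, Rabs (v y - v x) <= K * Rabs (u y - u x)) ->
  continuous u x -> continuous v x.
Proof.
  intros H Hu; apply filterlim_locally; intros eps.
  set (M := Rabs K + 1).
  assert (HM : 0 < M) by (unfold M; pose proof (Rabs_pos K); lra).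
  assert (He : 0 < eps / M) by (apply Rdiv_lt_0_compat; [apply cond_pos | exact HM]).
  generalize (proj1 (filterlim_locally _ _) Hu (mkposreal _ He)); apply filter_imp.
  intros y Hy; change (Rabs (u y - u x) < eps / M) in Hy.
  change (Rabs (v y - v x) < eps).
  apply Rle_lt_trans with (1 := H y).
  apply Rle_lt_trans with (M * Rabs (u y - u x)).
  - apply Rmult_le_compat_r; [apply Rabs_pos |].
    unfold M; pose proof (Rle_abs K); lra.
  - replace (pos eps) with (M * (eps / M)) by (field; lra).
    now apply Rmult_lt_compat_l.
Qed.

Lemma continuous_lipschitz (u : I01 -> R) :
  (forall x y : I01, Rabs (u y - u x) <= Rabs (y - x)) -> forall x, continuous u x.
Proof.
  intros H x; apply (continuous_dominated 1 I01_val u x).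
  - intros y; rewrite Rmult_1_l; apply H.
  - apply continuous_I01_val.
Qed.

Lemma continuous_Rmax_0 (u : I01 -> R) (x : I01) :
  continuous u x -> continuous (fun y => Rmax 0 (u y)) x.
Proof.
  apply (continuous_dominated 1 u (fun y => Rmax 0 (u y))); intros y.
  unfold Rmax, Rabs; repeat destruct (Rle_dec _ _); repeat destruct (Rcase_abs _); lra.
Qed.

Lemma distance_continuous (z x : I01) : continuous (fun y : I01 => Rabs (y - z)) x.
Proof.
  apply continuous_lipschitz; intros a b.
  unfold Rabs; repeat destruct (Rcase_abs _); lra.
Qed.

Lemma distance_bounds (z x : I01) : 0 <= Rabs (x - z) <= 1.
Proof.
  pose proof (I01_bounds x); pose proof (I01_bounds z).
  unfold Rabs; destruct (Rcase_abs _); lra.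
Qed.

Lemma distance_0 (z x : I01) : Rabs (x - z) = 0 -> x = z.
Proof.
  intros H; apply I01_eq.
  destruct (Req_dec (x - z) 0) as [E | N]; [lra | now apply Rabs_no_R0 in N].
Qed.

Lemma tent_continuous (z x : I01) : continuous (fun y : I01 => 1 - Rabs (y - z) / 2) x.
Proof.
  apply continuous_lipschitz; intros a b.
  unfold Rabs; repeat destruct (Rcase_abs _); lra.
Qed.

(** * The extension of the isometry *)

Lemma sup_norm_comp (g : I01 -> C) (tau sigma : I01 -> I01) :
  (forall x, continuous g x) -> (forall x, tau (sigma x) = x) ->
  sup_norm (fun x => g (tau x)) = sup_norm g.
Proof.
  intros Hg H; destruct (sup_norm_spec g Hg) as [[x Hx] Hub].
  apply sup_norm_eq; [exists (sigma x); now rewrite H | intros y; apply Hub].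
Qed.

Lemma norm_sigma_ext p (f g : C1_01) :
  Cmod (f I01_0) = Cmod (g I01_0) -> sup_norm (C1_deriv f) = sup_norm (C1_deriv g) ->
  norm_sigma p f = norm_sigma p g.
Proof. intros H1 H2; unfold norm_sigma; now rewrite H1, H2. Qed.

(** The element [W] is used for the continuity of [tau] and [sigma]: they are
    the derivatives of [Delta W] and of its preimage [Gamma W]. *)
Lemma extension_of_composition (p : Rbar) (Delta Gamma : pos_sphere p -> pos_sphere p)
    (sigma tau : I01 -> I01) (W : pos_sphere p) :
  (forall f, Delta (Gamma f) = f) ->
  (forall x, tau (sigma x) = x) -> (forall y, sigma (tau y) = y) ->
  (forall f, init (Delta f) = init f) ->
  (forall f y, slope (Delta f) y = slope f (tau y)) ->
  (forall x, slope W x = x) ->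
  exists T : C1_01 -> C1_01,
    linear_map T /\
    surjective T /\
    (forall f g : C1_01,
        norm_sigma p (minus (T f) (T g)) = norm_sigma p (minus f g)) /\
    (forall f : pos_sphere p, T (f : C1_01) = Delta f) /\
    exists tau : I01 -> I01,
      homeomorphism tau /\
      forall (f : C1_01) (t : I01),
        T f t = (f I01_0
                 + RInt (V := C_R_CompleteNormedModule)
                     (fun x : R => C1_deriv f (tau (clamp x))) 0 t)%C.
Proof.
  intros HG Hts Hst H0 Hs HW.
  assert (cont : forall (V : pos_sphere p) (rho : I01 -> I01),
    (forall x, slope V x = rho x) -> forall x, continuous rho x).
  { intros V rho HV x; apply filterlim_locally; intros eps.
    generalize (proj1 (filterlim_locally _ _) (slope_continuous V x) eps); apply filter_imp.
    intros y Hy; rewrite !HV in Hy; exact Hy. }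
  assert (Ctau : forall x, continuous tau x).
  { apply (cont (Delta W)); intros x; now rewrite Hs, HW. }
  assert (Csigma : forall x, continuous sigma x).
  { apply (cont (Gamma W)); intros x.
    now rewrite <- (Hts x) at 1; rewrite <- Hs, HG, HW. }
  assert (Ccomp : forall (f : C1_01) (rho : I01 -> I01), (forall x, continuous rho x) ->
    forall x, continuous (fun y => C1_deriv f (rho y)) x).
  { intros f rho Hrho x; apply continuous_comp; [apply Hrho | apply C1_contP]. }
  pose (T := fun f : C1_01 => C1_primitive (f I01_0) _ (Ccomp f tau Ctau)).
  assert (T0 : forall f, T f I01_0 = f I01_0) by (intros f; apply C1_primitive_0).
  assert (Td : forall f x, C1_deriv (T f) x = C1_deriv f (tau x)) by reflexivity.
  exists T; split; [split | split; [| split; [| split]]].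
  - intros f g; apply C1_determined; [| reflexivity].
    change ((T (plus f g)) I01_0 = (T f I01_0 + T g I01_0)%C); rewrite !T0; reflexivity.
  - intros c f; apply C1_determined; [| reflexivity].
    change ((T (scal c f)) I01_0 = (c * T f I01_0)%C); rewrite !T0; reflexivity.
  - intros g; exists (C1_primitive (g I01_0) _ (Ccomp g sigma Csigma)).
    apply C1_determined.
    + rewrite T0; apply C1_primitive_0.
    + intros x; simpl; now rewrite Hst.
  - intros f g; apply norm_sigma_ext.
    + change (Cmod (T f I01_0 + RtoC (-1) * T g I01_0)%C =
              Cmod (f I01_0 + RtoC (-1) * g I01_0)%C); now rewrite !T0.
    + exact (sup_norm_comp (C1_deriv (minus f g)) tau sigma (C1_contP _) Hts).
  - intros f; apply C1_determined.
    + now rewrite T0, !sphere_init_eq, H0.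
    + intros x; rewrite Td, !sphere_slope_eq, Hs; reflexivity.
  - exists tau; split; [| reflexivity].
    exists sigma; repeat split; assumption.
Qed.

(** * Finite exponents *)

(** Supremum norm of the derivative. *)
Definition slope_norm {p} (f : pos_sphere p) : R := sup_norm (C1_deriv f).

Lemma slope_norm_ge0 {p} (f : pos_sphere p) : 0 <= slope_norm f.
Proof. apply sup_norm_pos, C1_contP. Qed.

Lemma norm_sigma_pow (q : R) (f : C1_01) : 0 < q ->
  nnpow (norm_sigma (Finite q) f) q =
  nnpow (Cmod (f I01_0)) q + nnpow (sup_norm (C1_deriv f)) q.
Proof.
  intros Hq; simpl; apply nnpow_nnpow; [field; lra |].
  apply Rplus_le_le_0_compat; apply nnpow_ge_0; try exact Hq.
  - apply Cmod_ge_0.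
  - apply sup_norm_pos, C1_contP.
Qed.

Lemma sphere_pow (q : R) (f : pos_sphere (Finite q)) : 0 < q ->
  nnpow (init f) q + nnpow (slope_norm f) q = 1.
Proof.
  intros Hq; rewrite <- Cmod_init; unfold slope_norm.
  rewrite <- norm_sigma_pow by exact Hq.
  destruct f as [f [Hr [Hn Hp]]]; simpl in *; rewrite Hn; apply nnpow_1.
Qed.

Lemma nnpow_le_1_inv x q : 0 < q -> nnpow x q <= 1 -> x <= 1.
Proof.
  intros Hq H; apply Rnot_lt_le; intros Hx.
  pose proof (nnpow_lt 1 x q Hq ltac:(lra)); rewrite nnpow_1 in *; lra.
Qed.

Lemma init_le1 (q : R) (f : pos_sphere (Finite q)) : 0 < q -> init f <= 1.
Proof.
  intros Hq; apply (nnpow_le_1_inv _ q Hq).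
  pose proof (sphere_pow q f Hq).
  pose proof (nnpow_ge_0 _ q Hq (slope_norm_ge0 f)); lra.
Qed.

Lemma slope_norm_le1 (q : R) (f : pos_sphere (Finite q)) : 0 < q -> slope_norm f <= 1.
Proof.
  intros Hq; apply (nnpow_le_1_inv _ q Hq).
  pose proof (sphere_pow q f Hq).
  pose proof (nnpow_ge_0 _ q Hq (init_ge0 f)); lra.
Qed.

Lemma slope_le1 (q : R) (f : pos_sphere (Finite q)) x : 0 < q -> slope f x <= 1.
Proof.
  intros Hq; apply Rle_trans with (slope_norm f); [apply slope_sup | now apply slope_norm_le1].
Qed.

Lemma init_0_iff (q : R) (f : pos_sphere (Finite q)) : 0 < q ->
  init f = 0 <-> exists x, slope f x = 1.
Proof.
  intros Hq; pose proof (sphere_pow q f Hq) as H; split.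
  - intros E; rewrite E, nnpow_0, Rplus_0_l in H.
    destruct (slope_sup f) as [[x Hx] _]; exists x; rewrite Hx.
    apply (nnpow_inj _ _ q Hq (slope_norm_ge0 f)); [lra | now rewrite nnpow_1].
  - intros [x Hx]; apply (nnpow_inj _ _ q Hq (init_ge0 f)); [lra |].
    assert (slope_norm f = 1) as E.
    { apply Rle_antisym; [now apply slope_norm_le1 | rewrite <- Hx; apply slope_sup]. }
    rewrite E, nnpow_1 in H; rewrite nnpow_0; lra.
Qed.

Lemma init_1_slope (q : R) (f : pos_sphere (Finite q)) x : 0 < q ->
  init f = 1 -> slope f x = 0.
Proof.
  intros Hq E; pose proof (sphere_pow q f Hq) as H; rewrite E, nnpow_1 in H.
  assert (slope_norm f = 0) as E'.
  { apply (nnpow_inj _ _ q Hq (slope_norm_ge0 f)); [lra | rewrite nnpow_0; lra]. }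
  pose proof (slope_ge0 f x); pose proof (proj2 (slope_sup f) x) as Hx.
  fold (slope_norm f) in Hx; lra.
Qed.

(** Any slope with values in [0,1] occurs: the initial value is adjusted. *)
Lemma finite_make (q : R) (u : I01 -> R) : 0 < q ->
  (forall x, continuous u x) -> (forall x, 0 <= u x <= 1) ->
  exists f : pos_sphere (Finite q), forall x, slope f x = u x.
Proof.
  intros Hq Hu Hb.
  assert (Hq' : 0 < 1 / q) by (apply Rdiv_lt_0_compat; lra).
  assert (HcR : forall x, continuous (fun x => RtoC (u x)) x)
    by (intros x; apply continuous_RtoC, Hu).
  set (s := sup_norm (fun x => RtoC (u x))).
  assert (Hs0 : 0 <= s) by (apply sup_norm_pos, HcR).
  assert (HC : forall x, Cmod (RtoC (u x)) = u x)
    by (intros x; rewrite Cmod_R; apply Rabs_pos_eq, Hb).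
  destruct (sup_norm_spec _ HcR) as [[z Hz] Hmax]; 
  change (Cmod (RtoC (u z)) = s) in Hz; rewrite HC in Hz.
  change (forall x, Cmod (RtoC (u x)) <= s) in Hmax.
  assert (Hs1 : nnpow s q <= 1).
  { rewrite <- (nnpow_1 q); apply nnpow_le; [exact Hq |].
    specialize (Hb z); rewrite <- Hz; lra. }
  destruct (sphere_make (Finite q) (nnpow (1 - nnpow s q) (1 / q)) u Hu) as [f [_ Hf]].
  - apply nnpow_ge_0; [exact Hq' | lra].
  - apply Hb.
  - intros F HF0 HF.
    assert (E : sup_norm (C1_deriv F) = s).
    { apply sup_norm_eq; [exists z; now rewrite HF |].
      intros x; rewrite HF, <- HC; apply Hmax. }
    simpl; rewrite HF0, E, nnpow_nnpow by (try (field; lra); lra).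
    replace (1 - nnpow s q + nnpow s q) with 1 by ring; apply nnpow_1.
  - now exists f.
Qed.

(** For finite exponents the derivatives of the sphere form an evaluation
    family on [0,1], in which the functions attaining the value 1 are those
    with [f(0) = 0].  If [w] is a derivative, the positive part of [w - w(x)]
    is a nearest member of [zeros x]. *)
Lemma finite_evaluation_family (q : R) : 0 < q ->
  evaluation_family (X := pos_sphere (Finite q)) slope slope_dist (fun f => init f = 0).
Proof.
  intros Hq; split.
  - intros w x; apply slope_ge0.
  - intros v w x; apply slope_dist_ub.
  - intros x y H.
    destruct (finite_make q (fun y => Rabs (y - x)) Hq (distance_continuous x)
                (distance_bounds x)) as [h Hh].
    symmetry; apply distance_0; rewrite <- Hh; apply H; rewrite Hh.
    unfold Rminus; rewrite Rplus_opp_r; apply Rabs_R0.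
  - intros k Hk; now apply init_0_iff in Hk.
  - intros x.
    assert (Hb : forall y : I01, 0 <= 1 - Rabs (y - x) / 2 <= 1)
      by (intros y; pose proof (distance_bounds x y); lra).
    destruct (finite_make q _ Hq (tent_continuous x) Hb) as [k Hk].
    exists k; split.
    + apply init_0_iff; [exact Hq |]; exists x; rewrite Hk.
      unfold Rminus at 2; rewrite Rplus_opp_r, Rabs_R0; lra.
    + intros h Hh; destruct (slope_dist_attained h k) as [y Hy].
      rewrite <- Hy, Hk in Hh.
      pose proof (distance_bounds x y); pose proof (slope_ge0 h y).
      pose proof (slope_le1 q h y Hq).
      assert (Hhy : slope h y = 0 /\ Rabs (y - x) = 0).
      { unfold Rabs at 1 in Hh; destruct (Rcase_abs _); lra. }
      destruct Hhy as [Hhy Hyx]; apply distance_0 in Hyx; now subst y.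
  - intros w x; set (c := slope w x).
    destruct (finite_make q (fun y => Rmax 0 (slope w y - c)) Hq) as [h Hh].
    + intros y; apply continuous_Rmax_0.
      apply (continuous_dominated 1 (slope w) (fun y => slope w y - c)).
      * intros z; right; rewrite Rmult_1_l; f_equal; ring.
      * apply slope_continuous.
    + intros y; pose proof (slope_le1 q w y Hq).
      assert (Hc : 0 <= c) by apply slope_ge0.
      split; [apply Rmax_l | apply Rmax_lub; lra].
    + exists h; split.
      * rewrite Hh; apply Rmax_left; unfold c; lra.
      * destruct (slope_dist_attained w h) as [y <-]; rewrite Hh.
        assert (Hc : 0 <= c) by apply slope_ge0.
        pose proof (slope_ge0 w y); unfold Rmax, Rabs; destruct (Rle_dec _ _), (Rcase_abs _); lra.
Qed.

Lemma finite_dist_pow (q : R) (f g : pos_sphere (Finite q)) : 0 < q ->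
  nnpow (norm_sigma (Finite q) (minus (f : C1_01) (g : C1_01))) q =
  nnpow (Rabs (init f - init g)) q + nnpow (slope_dist f g) q.
Proof. intros Hq; rewrite norm_sigma_pow, Cmod_init_minus by exact Hq; reflexivity. Qed.

Lemma unit_difference a b : 0 <= a <= 1 -> 0 <= b <= 1 -> Rabs (a - b) <= 1.
Proof. intros; unfold Rabs; destruct (Rcase_abs _); lra. Qed.

(** The maximal distance is attained only between the pair [(1,0)] and a pair
    with vanishing first coordinate. *)
Lemma finite_antipodal (q : R) (f g : pos_sphere (Finite q)) : 0 < q ->
  nnpow (Rabs (init f - init g)) q + nnpow (slope_dist f g) q = 2 ->
  (init f = 1 /\ init g = 0) \/ (init f = 0 /\ init g = 1).
Proof.
  intros Hq H.
  pose proof (init_ge0 f); pose proof (init_ge0 g).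
  pose proof (init_le1 q f Hq); pose proof (init_le1 q g Hq).
  pose proof (unit_difference (init f) (init g) ltac:(lra) ltac:(lra)) as Hi.
  assert (Hs : slope_dist f g <= 1).
  { destruct (slope_dist_attained f g) as [x <-]; apply unit_difference; split;
      auto using slope_ge0, slope_le1. }
  pose proof (nnpow_le _ _ q Hq (conj (slope_dist_ge0 f g) Hs)) as P1.
  pose proof (nnpow_le _ _ q Hq (conj (Rabs_pos (init f - init g)) Hi)) as P2.
  rewrite nnpow_1 in P1, P2.
  assert (E : Rabs (init f - init g) = 1).
  { apply (nnpow_inj _ _ q Hq (Rabs_pos _)); [lra | rewrite nnpow_1; lra]. }
  unfold Rabs in E; destruct (Rcase_abs _); [right | left]; lra.
Qed.

(** A distance-preserving self-map of the sphere preserves the value at 0, and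
    hence the supremum distance of the derivatives. *)
Lemma finite_isometry_parts (q : R) (Delta : pos_sphere (Finite q) -> pos_sphere (Finite q)) :
  0 < q ->
  (forall f g : pos_sphere (Finite q),
     norm_sigma (Finite q) (minus (Delta f : C1_01) (Delta g : C1_01)) =
     norm_sigma (Finite q) (minus (f : C1_01) (g : C1_01))) ->
  (forall f, init (Delta f) = init f) /\
  (forall f g, slope_dist (Delta f) (Delta g) = slope_dist f g).
Proof.
  intros Hq HD.
  assert (Hpow : forall f g : pos_sphere (Finite q),
    nnpow (Rabs (init (Delta f) - init (Delta g))) q + nnpow (slope_dist (Delta f) (Delta g)) q
    = nnpow (Rabs (init f - init g)) q + nnpow (slope_dist f g) q).
  { intros f g; rewrite <- !finite_dist_pow, HD by exact Hq; reflexivity. }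
  destruct (finite_make q (fun _ => 0) Hq (fun x => continuous_const 0 x)
              ltac:(intros; lra)) as [e He].
  destruct (finite_make q (fun _ => 1) Hq (fun x => continuous_const 1 x)
              ltac:(intros; lra)) as [f1 Hf1].
  destruct (finite_make q I01_val Hq continuous_I01_val I01_bounds) as [f2 Hf2].
  assert (He1 : init e = 1).
  { pose proof (sphere_pow q e Hq) as H.
    assert (slope_norm e = 0) as E.
    { unfold slope_norm; destruct (slope_sup e) as [[x <-] _]; apply He. }
    rewrite E, nnpow_0, Rplus_0_r in H.
    apply (nnpow_inj _ _ q Hq (init_ge0 e)); [lra | now rewrite nnpow_1]. }
  assert (Hdist : forall g g' : pos_sphere (Finite q),
    (forall x, slope g x = 0) -> slope_dist g g' = slope_norm g').
  { intros g g' Hg; apply sup_norm_eq.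
    - destruct (slope_sup g') as [[x Hx] _]; exists x.
      rewrite Cmod_slope_minus, Hg, Hx.
      fold (slope_norm g'); rewrite Rminus_0_l, Rabs_Ropp.
      apply Rabs_pos_eq, slope_norm_ge0.
    - intros x; rewrite Cmod_slope_minus, Hg.
      rewrite Rminus_0_l, Rabs_Ropp, Rabs_pos_eq by apply slope_ge0.
      apply slope_sup. }
  assert (I1 : init f1 = 0) by (apply init_0_iff; [exact Hq | exists I01_0; apply Hf1]).
  assert (I2 : init f2 = 0).
  { apply init_0_iff; [exact Hq | exists (clamp 1)].
    rewrite Hf2; apply clamp_val; lra. }
  assert (far : forall g, init g = 0 ->
    nnpow (Rabs (init e - init g)) q + nnpow (slope_dist e g) q = 2).
  { intros g Hg; rewrite (Hdist e g He), He1, Hg, Rminus_0_r, Rabs_R1, nnpow_1.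
    pose proof (sphere_pow q g Hq) as H; rewrite Hg, nnpow_0 in H; lra. }
  (* The point [(1,0)] is at maximal distance from two different points; for a
     pair with vanishing first coordinate, only [(1,0)] is at that distance. *)
  assert (HDe : init (Delta e) = 1).
  { pose proof (far f1 I1) as F1; rewrite <- Hpow in F1.
    pose proof (far f2 I2) as F2; rewrite <- Hpow in F2.
    destruct (finite_antipodal q _ _ Hq F1) as [[H1 _] | [H1 J1]]; [exact H1 |].
    destruct (finite_antipodal q _ _ Hq F2) as [[H2 _] | [H2 J2]]; [exact H2 |].
    exfalso.
    assert (E : Delta f1 = Delta f2).
    { apply sphere_ext; [congruence |]; intros x.
      now rewrite !(init_1_slope q). }
    pose proof (Hpow f1 f2) as H; rewrite E, slope_dist_refl in H.
    unfold Rminus in H at 1; rewrite Rplus_opp_r, Rabs_R0, nnpow_0 in H.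
    rewrite I1, I2, Rminus_0_r, Rabs_R0, nnpow_0, !Rplus_0_l in H.
    assert (Z : slope_dist f1 f2 = 0).
    { apply (nnpow_inj _ _ q Hq (slope_dist_ge0 _ _)); [lra | now rewrite nnpow_0, <- H]. }
    apply (slope_dist_0 _ _ I01_0) in Z; rewrite Hf1, Hf2 in Z; simpl in Z; lra. }
  (* The distance from [(1,0)] to [(b,v)], raised to the power [q], is
     [(1-b)^q + 1 - b^q], a strictly decreasing function of [b]. *)
  assert (Hinit : forall f, init (Delta f) = init f).
  { intros f; pose proof (Hpow e f) as H.
    rewrite !Hdist, HDe, He1 in H
      by (first [exact He | intros x; now apply (init_1_slope q)]).
    pose proof (sphere_pow q f Hq); pose proof (sphere_pow q (Delta f) Hq).
    pose proof (init_ge0 f); pose proof (init_ge0 (Delta f)).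
    pose proof (init_le1 q f Hq); pose proof (init_le1 q (Delta f) Hq).
    rewrite !Rabs_pos_eq in H by lra.
    destruct (Rtotal_order (init (Delta f)) (init f)) as [L | [L | L]]; [| exact L |].
    - pose proof (nnpow_lt (init (Delta f)) (init f) q Hq ltac:(lra)).
      pose proof (nnpow_lt (1 - init f) (1 - init (Delta f)) q Hq ltac:(lra)); lra.
    - pose proof (nnpow_lt (init f) (init (Delta f)) q Hq ltac:(lra)).
      pose proof (nnpow_lt (1 - init (Delta f)) (1 - init f) q Hq ltac:(lra)); lra. }
  split; [exact Hinit |]; intros f g.
  apply (nnpow_inj _ _ q Hq); try apply slope_dist_ge0.
  pose proof (Hpow f g) as H; rewrite !Hinit in H; lra.
Qed.

(** * The exponent infinity *)

Lemma infinite_make (a : R) (u : I01 -> R) :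
  (forall x, continuous u x) -> 0 <= a <= 1 -> (forall x, 0 <= u x <= 1) ->
  a = 1 \/ (exists x, u x = 1) ->
  exists f : pos_sphere p_infty, init f = a /\ forall x, slope f x = u x.
Proof.
  intros Hu Ha Hb H1.
  apply sphere_make; [exact Hu | lra | apply Hb |].
  intros F HF0 HF; simpl; rewrite HF0.
  destruct (sup_norm_spec _ (C1_contP F)) as [[z Hz] Hmax].
  rewrite HF in Hz; pose proof (Hb z).
  destruct H1 as [-> | [x Hx]].
  - apply Rmax_left; lra.
  - specialize (Hmax x); rewrite HF, Hx in Hmax.
    rewrite Rmax_right; lra.
Qed.

Lemma infinite_norm (f : pos_sphere p_infty) : Rmax (init f) (slope_norm f) = 1.
Proof.
  rewrite <- Cmod_init; destruct f as [f [Hr [Hn Hp]]]; exact Hn.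
Qed.

Lemma infinite_bounds (f : pos_sphere p_infty) :
  0 <= init f <= 1 /\ forall x, 0 <= slope f x <= 1.
Proof.
  pose proof (infinite_norm f) as H.
  split; [split; [apply init_ge0 | rewrite <- H; apply Rmax_l] |].
  intros x; split; [apply slope_ge0 |].
  rewrite <- H; apply Rle_trans with (2 := Rmax_r _ _); apply slope_sup.
Qed.

Lemma infinite_attained (f : pos_sphere p_infty) : init f = 1 \/ exists x, slope f x = 1.
Proof.
  pose proof (infinite_norm f) as H; destruct (slope_sup f) as [[x Hx] _].
  fold (slope_norm f) in Hx; rewrite <- Hx in H.
  unfold Rmax in H; destruct (Rle_dec _ _); [right; now exists x | now left].
Qed.

(** For [p = infinity] a pair (value at 0, derivative) is a function on the
    disjoint union of a point and the interval. *)
Definition value (f : pos_sphere p_infty) (x : option I01) : R :=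
  match x with None => init f | Some x => slope f x end.

(** The distance of the positive sphere for [p = infinity]. *)
Definition sphere_dist (f g : pos_sphere p_infty) : R :=
  norm_sigma p_infty (minus (f : C1_01) (g : C1_01)).

Lemma sphere_dist_eq f g :
  sphere_dist f g = Rmax (Rabs (init f - init g)) (slope_dist f g).
Proof. rewrite <- Cmod_init_minus; reflexivity. Qed.

Lemma sphere_dist_le f g m :
  Rabs (init f - init g) <= m -> (forall x, Rabs (slope f x - slope g x) <= m) ->
  sphere_dist f g <= m.
Proof.
  intros H0 H; rewrite sphere_dist_eq; apply Rmax_lub; [exact H0 |].
  destruct (slope_dist_attained f g) as [x <-]; apply H.
Qed.

Lemma sphere_dist_attained f g : exists x, Rabs (value f x - value g x) = sphere_dist f g.
Proof.
  rewrite sphere_dist_eq; destruct (slope_dist_attained f g) as [x <-].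
  apply Rmax_case; [exists None | exists (Some x)]; reflexivity.
Qed.

Lemma value_bounds f x : 0 <= value f x <= 1.
Proof. destruct x; apply infinite_bounds. Qed.

(** If [w] takes the value 1 at [x], any member of [zeros x] is nearest to [w],
    since no distance exceeds 1. *)
Lemma infinite_evaluation_family :
  evaluation_family value sphere_dist (fun _ => True).
Proof.
  assert (Z : forall x : I01, Rabs (x - x) = 0)
    by (intros x; unfold Rminus; rewrite Rplus_opp_r; apply Rabs_R0).
  destruct (infinite_make 0 (fun _ => 1) (fun x => continuous_const 1 x)
    ltac:(lra) ltac:(intros; lra) (or_intror (ex_intro _ I01_0 eq_refl))) as [h1 [H10 H1]].
  assert (Hdist : forall x : I01, exists h : pos_sphere p_infty,
    init h = 1 /\ forall y : I01, slope h y = Rabs (y - x)).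
  { intros x; apply infinite_make;
      [apply distance_continuous | lra | apply distance_bounds | now left]. }
  split.
  - intros w x; apply value_bounds.
  - intros v w [x |]; rewrite sphere_dist_eq.
    + apply Rle_trans with (2 := Rmax_r _ _), slope_dist_ub.
    + apply Rmax_l.
  - intros [x |] [y |] H.
    + destruct (Hdist x) as [h [Hh0 Hh]].
      f_equal; symmetry; apply distance_0; rewrite <- Hh; apply (H h).
      simpl; rewrite Hh; apply Z.
    + destruct (Hdist x) as [h [Hh0 Hh]].
      specialize (H h); simpl in H; rewrite Hh, Hh0, Z in H.
      specialize (H eq_refl); lra.
    + specialize (H h1); simpl in H; rewrite H10, H1 in H.
      specialize (H eq_refl); lra.
    + reflexivity.
  - intros k _; destruct (infinite_attained k) as [H | [x H]];
      [now exists None | now exists (Some x)].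
  - intros [x |].
    + destruct (infinite_make (1 / 2) _ (tent_continuous x)) as [k [Hk0 Hk]].
      * lra.
      * intros y; pose proof (distance_bounds x y); lra.
      * right; exists x; rewrite Z; lra.
      * exists k; split; [exact I |]; intros h Hh.
        destruct (sphere_dist_attained h k) as [[y |] Hy];
          rewrite <- Hy in Hh; simpl in Hh.
        -- rewrite Hk in Hh; pose proof (distance_bounds x y).
           destruct (infinite_bounds h) as [_ Hb]; specialize (Hb y).
           assert (Hhy : slope h y = 0 /\ Rabs (y - x) = 0).
           { unfold Rabs at 1 in Hh; destruct (Rcase_abs _); lra. }
           destruct Hhy as [Hhy Hyx]; apply distance_0 in Hyx; now subst y.
        -- destruct (infinite_bounds h) as [Hb _]; rewrite Hk0 in Hh.
           unfold Rabs in Hh; destruct (Rcase_abs _); lra.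
    + destruct (infinite_make 1 (fun _ => 1 / 2) (fun x => continuous_const (1 / 2) x))
        as [k [Hk0 Hk]]; [lra | intros; lra | now left |].
      exists k; split; [exact I |]; intros h Hh.
      destruct (sphere_dist_attained h k) as [[y |] Hy];
        rewrite <- Hy in Hh; simpl in Hh |- *.
      * rewrite Hk in Hh; destruct (infinite_bounds h) as [_ Hb]; specialize (Hb y).
        unfold Rabs in Hh; destruct (Rcase_abs _); lra.
      * rewrite Hk0 in Hh; destruct (infinite_bounds h) as [Hb _].
        unfold Rabs in Hh; destruct (Rcase_abs _); lra.
  - intros w x; set (c := value w x).
    assert (Hc : 0 <= c <= 1) by apply value_bounds.
    assert (Hone : forall h, c = 1 -> sphere_dist w h <= c).
    { intros h ->; destruct (sphere_dist_attained w h) as [y <-].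
      apply unit_difference; apply value_bounds. }
    destruct (Req_dec c 1) as [E | N].
    + destruct x as [x |].
      * destruct (Hdist x) as [h [Hh0 Hh]]; exists h; split; [| now apply Hone].
        simpl; rewrite Hh; apply Z.
      * exists h1; split; [exact H10 | now apply Hone].
    + (* [phi] sends [c] to 0, fixes 1 and moves no point of [0,1] by more than
         [c], so [phi o w] still has norm 1 and is a nearest function. *)
      pose (phi := fun r => Rmax 0 ((r - c) / (1 - c))).
      assert (Hphi : forall r, 0 <= r <= 1 -> 0 <= phi r <= 1 /\ Rabs (r - phi r) <= c).
      { intros r Hr; unfold phi.
        set (s := (r - c) / (1 - c)).
        assert (Es : s * (1 - c) = r - c) by (unfold s; field; lra).
        assert (s <= 1) by nra.
        unfold Rmax; destruct (Rle_dec 0 s).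
        - split; [lra |]; rewrite Rabs_pos_eq; nra.
        - split; [lra |]; rewrite Rminus_0_r, Rabs_pos_eq; nra. }
      assert (phi1 : phi 1 = 1).
      { unfold phi; replace ((1 - c) / (1 - c)) with 1 by (field; lra).
        apply Rmax_right; lra. }
      assert (phic : phi c = 0).
      { unfold phi; replace ((c - c) / (1 - c)) with 0 by (field; lra).
        apply Rmax_left; lra. }
      destruct (infinite_bounds w) as [Hw0 Hw].
      destruct (infinite_make (phi (init w)) (fun y => phi (slope w y))) as [h [Hh0 Hh]].
      * intros y; apply continuous_Rmax_0.
        apply (continuous_dominated (/ (1 - c)) (slope w)
                 (fun y => (slope w y - c) / (1 - c))); [| apply slope_continuous].
        intros z; right; rewrite <- (Rabs_pos_eq (/ (1 - c))), <- Rabs_mult.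
        -- f_equal; field; lra.
        -- left; apply Rinv_0_lt_compat; lra.
      * apply Hphi, Hw0.
      * intros y; apply Hphi, Hw.
      * destruct (infinite_attained w) as [H | [y H]];
          [left | right; exists y]; now rewrite H.
      * exists h; split.
        -- destruct x as [x |]; simpl; [rewrite Hh | rewrite Hh0]; exact phic.
        -- apply sphere_dist_le; [rewrite Hh0; apply Hphi, Hw0 |].
           intros y; rewrite Hh; apply Hphi, Hw.
Qed.

(** A continuous function on the interval with values 0 and 1 is constant. *)
Lemma two_valued_constant (u : I01 -> R) :
  (forall x, continuous u x) -> (forall x, u x = 0 \/ u x = 1) -> forall x y, u x = u y.
Proof.
  intros Hu H01.
  assert (A : forall x y, u x = 0 -> u y = 1 -> False).
  { intros x y Hx Hy.
    destruct (IVT_gen_consistent (fun t => u (clamp t)) x y (1 / 2)) as [t [_ Ht]].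
    - apply continuous_clamp_comp, Hu.
    - rewrite !clamp_id, Hx, Hy, Rmin_left, Rmax_right; lra.
    - destruct (H01 (clamp t)); lra. }
  intros x y; destruct (H01 x), (H01 y); try congruence; exfalso; eauto.
Qed.

(** Otherwise the derivative of the image of the pair [(1,0)] would be constant
    and equal to 1, and [tau] would map the whole interval to the added point. *)
Lemma infinite_isolated_point (Phi : pos_sphere p_infty -> pos_sphere p_infty)
    (sigma tau : option I01 -> option I01) :
  (forall x, tau (sigma x) = x) -> (forall y, sigma (tau y) = y) ->
  (forall w y, value (Phi w) y = value w (tau y)) -> sigma None = None.
Proof.
  intros Hts Hst HPhi.
  destruct (infinite_make 1 (fun _ => 0) (fun x => continuous_const 0 x)) as [e [He0 He]];
    [lra | intros; lra | now left |].
  assert (Hval : forall y, value (Phi e) y = match tau y with None => 1 | _ => 0 end).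
  { intros y; rewrite HPhi; destruct (tau y); [apply He | exact He0]. }
  destruct (sigma None) as [z |] eqn:Ez; [exfalso | reflexivity].
  assert (Hz : tau (Some z) = None) by (rewrite <- Ez; apply Hts).
  assert (Hconst : forall x, slope (Phi e) x = 1).
  { intros x; rewrite (two_valued_constant _ (slope_continuous (Phi e))) with (y := z).
    - change (value (Phi e) (Some z) = 1); now rewrite Hval, Hz.
    - intros y; change (value (Phi e) (Some y) = 0 \/ value (Phi e) (Some y) = 1).
      rewrite Hval; destruct (tau (Some y)); auto. }
  assert (Hnone : forall x, tau (Some x) = None).
  { intros x; pose proof (Hval (Some x)) as H; simpl in H; rewrite Hconst in H.
    destruct (tau (Some x)); [lra | reflexivity]. }
  assert (E : (Some (clamp 0) : option I01) = Some (clamp 1)).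
  { rewrite <- (Hst (Some (clamp 0))), <- (Hst (Some (clamp 1))), !Hnone; reflexivity. }
  assert (E' : (clamp 0 : R) = (clamp 1 : R)).
  { exact (f_equal (fun o => match o with Some x => I01_val x | None => 0 end) E). }
  rewrite !clamp_val in E' by lra; lra.
Qed.

Theorem theorem1p1 (p : Rbar) (hp : Rbar_le (Finite 1) p)
    (Delta : pos_sphere p -> pos_sphere p)
    (Delta_surj : surjective Delta)
    (Delta_isom : forall f g : pos_sphere p,
        norm_sigma p (minus (Delta f : C1_01) (Delta g : C1_01))
        = norm_sigma p (minus (f : C1_01) (g : C1_01))) :
  exists T : C1_01 -> C1_01,
    linear_map T /\
    surjective T /\
    (forall f g : C1_01,
        norm_sigma p (minus (T f) (T g)) = norm_sigma p (minus f g)) /\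
    (forall f : pos_sphere p, T (f : C1_01) = Delta f) /\
    exists tau : I01 -> I01,
      homeomorphism tau /\
      forall (f : C1_01) (t : I01),
        T f t = (f I01_0
                 + RInt (V := C_R_CompleteNormedModule)
                     (fun x : R => C1_deriv f (tau (clamp x))) 0 t)%C.
Proof.
  destruct (functional_choice _ Delta_surj) as [Gamma HG].
  assert (Gamma_isom : forall f g : pos_sphere p,
    norm_sigma p (minus (Gamma f : C1_01) (Gamma g : C1_01)) =
    norm_sigma p (minus (f : C1_01) (g : C1_01))).
  { intros f g; rewrite <- Delta_isom, !HG; reflexivity. }
  destruct p as [q | |]; [| | contradiction].
  - assert (Hq : 0 < q) by (simpl in hp; lra).
    destruct (finite_isometry_parts q Delta Hq Delta_isom) as [D0 Dd].
    destruct (finite_isometry_parts q Gamma Hq Gamma_isom) as [G0 Gd].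
    assert (HG' : forall f, Gamma (Delta f) = f).
    { intros f; apply sphere_ext; [now rewrite G0, D0 |].
      intros x; apply slope_dist_0.
      rewrite <- Dd, HG; apply slope_dist_refl. }
    destruct (isometry_is_composition _ _ _ (finite_evaluation_family q Hq) Delta Gamma)
      as [sigma [tau [Hts [Hst Hval]]]]; try assumption.
    { intros f Hf; now rewrite D0. }
    { intros f Hf; now rewrite G0. }
    destruct (finite_make q I01_val Hq continuous_I01_val I01_bounds) as [W HW].
    exact (extension_of_composition _ Delta Gamma sigma tau W HG Hts Hst D0 Hval HW).
  - assert (HG' : forall f, Gamma (Delta f) = f).
    { intros f.
      assert (E : sphere_dist (Gamma (Delta f)) f = 0).
      { unfold sphere_dist; rewrite <- Delta_isom, HG.
        fold (sphere_dist (Delta f) (Delta f)).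
        rewrite sphere_dist_eq, slope_dist_refl.
        unfold Rminus; rewrite Rplus_opp_r, Rabs_R0; apply Rmax_left; lra. }
      pose proof (ev_dist _ _ _ infinite_evaluation_family (Gamma (Delta f)) f) as Hd.
      rewrite E in Hd.
      assert (Heq : forall x, value (Gamma (Delta f)) x = value f x).
      { intros x; specialize (Hd x); unfold Rabs in Hd.
        destruct (Rcase_abs _); lra. }
      apply sphere_ext; [exact (Heq None) | intros x; exact (Heq (Some x))]. }
    destruct (isometry_is_composition _ _ _ infinite_evaluation_family Delta Gamma)
      as [sigma [tau [Hts [Hst Hval]]]]; try (assumption || (intros; exact I)).
    assert (Sn : sigma None = None)
      by exact (infinite_isolated_point Delta sigma tau Hts Hst Hval).
    assert (Tn : tau None = None) by (pose proof (Hts None) as H; rewrite Sn in H; exact H).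
    pose (restrict := fun (rho : option I01 -> option I01) (x : I01) =>
      match rho (Some x) with Some y => y | None => x end).
    assert (Srestrict : forall x, sigma (Some x) = Some (restrict sigma x)).
    { intros x; unfold restrict; destruct (sigma (Some x)) eqn:E; [reflexivity |].
      pose proof (Hts (Some x)); congruence. }
    assert (Trestrict : forall x, tau (Some x) = Some (restrict tau x)).
    { intros x; unfold restrict; destruct (tau (Some x)) eqn:E; [reflexivity |].
      pose proof (Hst (Some x)); congruence. }
    destruct (infinite_make 0 I01_val continuous_I01_val) as [W [_ HW]].
    { lra. }
    { apply I01_bounds. }
    { right; exists (clamp 1); apply clamp_val; lra. }
    apply (extension_of_composition _ Delta Gamma (restrict sigma) (restrict tau) W HG).
    + intros x; pose proof (Hts (Some x)) as H.
      rewrite Srestrict, Trestrict in H; congruence.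
    + intros x; pose proof (Hst (Some x)) as H.
      rewrite Trestrict, Srestrict in H; congruence.
    + intros f; pose proof (Hval f None) as H; rewrite Tn in H; exact H.
    + intros f y; pose proof (Hval f (Some y)) as H; rewrite Trestrict in H; exact H.
    + exact HW.
Qed.
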